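(* All non-identity elements of $F$ act on $X$ as ballistic isometries, with translation lengths uniformly bounded away from zero. More precisely, the translation length of any non-identity element of $F$ is at least $\sqrt2$, and the constant $\sqrt 2$ is sharp.
   Context: Thompson-like functions. For an integer $n\ge 1$ let $F_n$ be the set of piecewise linear homeomorphisms $g:[0,1]\to[0,n]$ with finitely many breaking points, all at dyadic rationals, and all slopes (integer) powers of $2$ (so $g$ is increasing). $F=F_1$ is Thompson's group and $F_\infty=\bigcup_{n\ge1}F_n$. Put $[n]=\{1,\dots,n\}$. For $J\subseteq[n]$ let $s_{n,J}:[0,n]\to[0,n+|J|]$ be the increasing piecewise linear bijection with slope $2$ on $[j-1,j]$ for $j\in J$ and slope $1$ on the other intervals $[j-1,j]$. For $g\in F_n$ put $g[J]=s_{n,J}\circ g\in F_{n+|J|}$. The complex $X$. For $g\in F_n$ let $C(g)$ be an $n$-dimensional unit cube $[0,1]^n$ whose vertex $\chi_J$ (the characteristic vector of $J\subseteq[n]$) is labeled by $g[J]$. $X$ is the cubical complex obtained by gluing the cubes $C(g)$, $g\in F_\infty$, along faces with the same labels; its vertex set is $F_\infty$. It carries the length metric $d$ for which every cube is a Euclidean unit cube; with it $X$ is a $CAT(0)$ space. The action. The group law of $F$ is taken in the order $gh:=h\circ g$, and $F$ acts on $X$ from the left by cubical isometries, given on vertices by $g\cdot x=x\circ g$. The translation length of an isometry $g$ is $|g|=\inf_{x\in X}d(gx,x)$; $g$ is ballistic if $|g|>0$. *)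

(* Defs.v *)
From HB Require Import structures.
From Stdlib Require Import Relations.
From mathcomp Require Import all_boot all_order all_algebra generic_quotient.
From mathcomp Require Import all_classical all_reals all_analysis.
From mathcomp Require Import ring lra.

Set Implicit Arguments.
Unset Strict Implicit.
Unset Printing Implicit Defensive.

Import Order.TTheory GRing.Theory Num.Theory.
Import numFieldNormedType.Exports.

Local Open Scope classical_set_scope.
Local Open Scope quotient_scope.
Local Open Scope ring_scope.

Section ThompsonLike.
Context {R : realType}.

Definition dyadic (x : R) : Prop :=
  exists (m : int) (k : nat), x = m%:~R / 2 ^+ k.

(* [g] has finitely many breaking points, all of them dyadic, and all its
   slopes are integer powers of 2; [s] lists (at least) all breaking points. *)
Definition dyadic_PL (g : R -> R) : Prop :=
  exists s : seq R,
    (forall b, b \in s -> dyadic b) /\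
    forall a b : R, 0 <= a -> a < b -> b <= 1 ->
      (forall x, a < x < b -> x \notin s) ->
      exists (k : int) (c : R), forall x, a < x < b -> g x = 2 ^ k * x + c.

(* A function on [0,1] is represented by a function on [R] vanishing outside
   [0,1]; in this way Leibniz equality is equality of functions on [0,1], and,
   as the functions considered vanish at 0, composition is plain [\o].
   A continuous bijection between compact intervals is a homeomorphism. No
   function satisfies this predicate for n = 0. *)
Definition thompson_like (n : nat) (g : R -> R) : Prop :=
  [/\ set_bij `[0, 1] `[0, n%:R] g,
      {within `[0, 1], continuous g},
      dyadic_PL g &
      forall x, x \notin `[0, 1] -> g x = 0].

(* The set F_n; Thompson's group F is [thompson 1]. *)
Record thompson (n : nat) := Thompson {
  thompson_fun :> R -> R;
  thompson_funP : thompson_like n thompson_fun }.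

Lemma PL_closed (g : R -> R) (a b : R) (k : int) (c : R) :
  0 <= a -> a < b -> b <= 1 -> {within `[0, 1], continuous g} ->
  (forall x, a < x < b -> g x = 2 ^ k * x + c) ->
  forall x, a <= x <= b -> g x = 2 ^ k * x + c.
Proof.
move=> a0 ab b1 cg gE.
have cab : {within `[a, b], continuous g}.
  apply: continuous_subspaceW cg => x /=; rewrite !in_itv/= => /andP[? ?].
  by apply/andP; split; [exact: le_trans a0 _|exact: le_trans b1].
have [_ ga gb] := (continuous_within_itvP g ab).1 cab.
have cf (y : R) : (fun x => 2 ^ k * x + c) @ y --> 2 ^ k * y + c.
  by apply: cvgD; [apply: cvgM; [exact: cvg_cst|exact: cvg_id]|exact: cvg_cst].
have gaE : g a = 2 ^ k * a + c.
  apply: (@cvg_unique _ _ (g @ a^'+)) => //.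
  apply: cvg_trans (cvg_at_right_filter (cf a)); apply: near_eq_cvg.
  by near=> x; rewrite gE//; apply/andP; split; near: x;
    [exact: nbhs_right_gt|exact: nbhs_right_lt].
have gbE : g b = 2 ^ k * b + c.
  apply: (@cvg_unique _ _ (g @ b^'-)) => //.
  apply: cvg_trans (cvg_at_left_filter (cf b)); apply: near_eq_cvg.
  by near=> x; rewrite gE//; apply/andP; split; near: x;
    [exact: nbhs_left_gt|exact: nbhs_left_lt].
move=> x /andP[]; rewrite !le_eqVlt => /orP[/eqP<-//|ax] /orP[/eqP->//|xb].
by rewrite gE// ax.
Unshelve. all: by end_near. Qed.


Lemma subdivision_ind (s : seq R) (P : R -> R -> Prop) :
  (forall x y, 0 <= x -> x < y -> y <= 1 ->
     (forall z, x < z < y -> z \notin s) -> P x y) ->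
  (forall x b y, 0 <= x -> x < b -> b < y -> y <= 1 -> b \in s ->
     P x b -> P b y -> P x y) ->
  forall x y, 0 <= x -> x < y -> y <= 1 -> P x y.
Proof.
elim: s => [base _ x y x0 xy y1|c s IH base step]; first exact: base.
apply: IH => [x y x0 xy y1 nb|x b y x0 xb yb y1 bs].
- have [/andP[xc cy]|nc] := boolP (x < c < y).
  + apply: (step x c y) => //; rewrite ?mem_head//; apply: base => //.
    * by rewrite (le_trans (ltW cy)).
    * move=> z /andP[xz zc]; rewrite inE negb_or lt_eqF//= nb// xz.
      exact: lt_trans cy.
    * by rewrite (le_trans x0)// ltW.
    * move=> z /andP[cz zy]; rewrite inE negb_or gt_eqF//= nb// zy.
      by rewrite (lt_trans xc cz).
  + apply: base => // z zxy; rewrite inE negb_or nb// andbT.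
    by apply: contra nc => /eqP <-.
- by apply: step => //; rewrite inE bs orbT.
Qed.

Lemma thompson_piece n (g : R -> R) (s : seq R) :
  thompson_like n g ->
  (forall a b : R, 0 <= a -> a < b -> b <= 1 ->
      (forall x, a < x < b -> x \notin s) ->
      exists (k : int) (c : R), forall x, a < x < b -> g x = 2 ^ k * x + c) ->
  forall a b : R, 0 <= a -> a < b -> b <= 1 ->
      (forall x, a < x < b -> x \notin s) ->
      exists (k : int) (c : R), forall x, a <= x <= b -> g x = 2 ^ k * x + c.
Proof.
move=> [_ cg _ _] sP a b a0 ab b1 nb; have [k [c gE]] := sP a b a0 ab b1 nb.
by exists k, c; exact: (PL_closed a0 ab b1 cg gE).
Qed.

Lemma thompson_incr n (g : R -> R) : thompson_like n g ->
  forall x y, 0 <= x -> x < y -> y <= 1 -> g x < g y.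
Proof.
move=> gF; have [_ _ [s [_ /(thompson_piece gF) sP]] _] := gF.
apply: (@subdivision_ind s) => [x y x0 xy y1 nb|x b y _ _ _ _ _]; last exact: lt_trans.
have [k [c gE]] := sP x y x0 xy y1 nb.
by rewrite !gE ?lexx ?ltW// ltrD2r ltr_pM2l// exprz_gt0.
Qed.

Lemma thompson_lt n (g : R -> R) : thompson_like n g ->
  forall x y, 0 <= x -> y <= 1 -> 0 <= y -> x <= 1 -> (g x < g y) = (x < y).
Proof.
move=> gF x y x0 y1 y0 x1; have [xy|yx|->] := ltgtP x y; last by rewrite ltxx.
- exact: thompson_incr gF _ _ x0 xy y1.
- by apply/negbTE; rewrite -leNgt ltW// (thompson_incr gF y0 yx x1).
Qed.

Lemma thompson_bound n (g : R -> R) : thompson_like n g ->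
  forall x, 0 <= x <= 1 -> 0 <= g x <= n%:R.
Proof.
by move=> [[gf _ _] _ _ _] x x01; have := gf x; rewrite /= !in_itv/=; exact.
Qed.

Lemma thompson_surj n (g : R -> R) : thompson_like n g ->
  forall y, 0 <= y <= n%:R -> exists2 x, 0 <= x <= 1 & g x = y.
Proof.
move=> [[_ _ gs] _ _ _] y y0n; have := gs y; rewrite /= in_itv/= => /(_ y0n).
by move=> [x /=]; rewrite in_itv/= => x01 gx; exists x.
Qed.

Lemma thompson_inj n (g : R -> R) : thompson_like n g ->
  forall x y, 0 <= x <= 1 -> 0 <= y <= 1 -> g x = g y -> x = y.
Proof.
by move=> [[_ gi _] _ _ _] x y x01 y01; apply: gi; rewrite inE/= in_itv.
Qed.

Lemma thompson0 n (g : R -> R) : thompson_like n g -> g 0 = 0.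
Proof.
move=> gF; have z0n : 0 <= (0 : R) <= n%:R by rewrite lexx ler0n.
have [x /andP[x0 x1] gx] := thompson_surj gF z0n.
have z01 : 0 <= (0 : R) <= 1 by rewrite lexx ler01.
have /andP[g0 _] := thompson_bound gF z01.
apply/eqP; rewrite eq_le g0 andbT -[leRHS]gx leNgt (thompson_lt gF)//.
by rewrite -leNgt.
Qed.

Lemma thompson1 n (g : R -> R) : thompson_like n g -> g 1 = n%:R.
Proof.
move=> gF; have n0n : 0 <= (n%:R : R) <= n%:R by rewrite lexx ler0n.
have [x /andP[x0 x1] gx] := thompson_surj gF n0n.
have l01 : 0 <= (1 : R) <= 1 by rewrite lexx ler01.
have /andP[_ g1] := thompson_bound gF l01.
apply/eqP; rewrite eq_le g1 -[leLHS]gx leNgt (thompson_lt gF)//.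
by rewrite -leNgt.
Qed.

Lemma dyadicD x y : dyadic x -> dyadic y -> dyadic (x + y).
Proof.
move=> [m [k ->]] [m' [k' ->]]; exists (m * 2 ^+ k' + m' * 2 ^+ k), (k + k')%N.
rewrite rmorphD !rmorphM !rmorphXn/= exprD.
have nz j : (2 : R) ^+ j != 0 by rewrite expf_neq0.
by field; rewrite !nz.
Qed.

Lemma dyadicN x : dyadic x -> dyadic (- x).
Proof. by move=> [m [k ->]]; exists (- m), k; rewrite rmorphN mulNr. Qed.

Lemma dyadic_exprz (k : int) x : dyadic x -> dyadic (2 ^ k * x).
Proof.
move=> [m [l ->]]; have nz j : (2 : R) ^+ j != 0 by rewrite expf_neq0.
case: k => j.
- exists (2 ^+ j * m), l; rewrite rmorphM rmorphXn/= -exprnP.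
  by rewrite mulrA.
- exists m, (j.+1 + l)%N; rewrite NegzE -exprnN exprD invfM.
  by rewrite mulrCA.
Qed.

Lemma thompson_dyadic n (g : R -> R) : thompson_like n g ->
  forall x, 0 <= x <= 1 -> dyadic (g x) -> dyadic x.
Proof.
move=> gF; have [_ _ [s [sd /(thompson_piece gF) sP]] _] := gF.
have [d0 d1] : dyadic 0 /\ dyadic 1.
  by split; [exists 0, 0%N|exists 1, 0%N]; rewrite ?mul0r// divr1.
suff H : forall x y, 0 <= x -> x < y -> y <= 1 -> dyadic x -> dyadic (g x) ->
    forall z, x <= z <= y -> (dyadic z <-> dyadic (g z)).
  move=> x x01; have := H 0 1 (lexx _) ltr01 (lexx _) d0.
  by rewrite (thompson0 gF) => /(_ d0 x x01)[].
apply: (@subdivision_ind s) => [x y x0 xy y1 nb dx dgx z xzy|x b y].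
- have [k [c gE]] := sP x y x0 xy y1 nb.
  have gz : g z = g x + 2 ^ k * (z - x).
    by rewrite !gE ?lexx ?(ltW xy)//; ring.
  have zE : z = x + 2 ^ (- k) * (g z - g x).
    rewrite gz addrAC subrr add0r mulrA -expfzDr ?pnatr_eq0// addNr expr0z.
    by rewrite mul1r addrC subrK.
  split=> dz.
  + by rewrite gz; apply: dyadicD => //; apply/dyadic_exprz/dyadicD => //;
      apply: dyadicN.
  + by rewrite zE; apply: dyadicD => //; apply/dyadic_exprz/dyadicD => //;
      apply: dyadicN.
- move=> x0 xb yb y1 bs Pxb Pby dx dgx z /andP[xz zy].
  have [zb|bz] := leP z b; first by apply: Pxb => //; rewrite xz.
  apply: Pby; rewrite ?(ltW bz) ?zy//; first exact: sd.
  by apply: (Pxb dx dgx b _).1; rewrite ?lexx ?(ltW xb)//; exact: sd.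
Qed.

Lemma thompson_comp n (g f : R -> R) :
  thompson_like n g -> thompson_like 1 f -> thompson_like n (g \o f).
Proof.
move=> gF fF.
have fb x : 0 <= x <= 1 -> 0 <= f x <= 1 := thompson_bound fF (x := x).
have bij : set_bij `[0, 1] `[0, n%:R] (g \o f).
  by apply: (set_bij_comp (B := `[0, 1%:R])); [case: fF|case: gF].
have incr x y : 0 <= x -> x < y -> y <= 1 -> g (f x) < g (f y).
  move=> x0 xy y1; have y0 : 0 <= y by exact: le_trans x0 (ltW xy).
  have x1 : x <= 1 by exact: le_trans (ltW xy) y1.
  have /andP[fx0 _] : 0 <= f x <= 1 by apply: fb; rewrite x0.
  have /andP[_ fy1] : 0 <= f y <= 1 by apply: fb; rewrite y0.
  exact: (thompson_incr gF) fx0 (thompson_incr fF x0 xy y1) fy1.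
split => //.
- apply: segment_inc_surj_continuous.
  + move=> x y; rewrite !in_itv/= => /andP[x0 x1] /andP[y0 y1].
    have [xy|yx|->] := ltgtP x y; last by rewrite lexx.
    * by rewrite ltW// incr.
    * by apply/negbTE; rewrite -ltNge incr.
  + rewrite /= (thompson0 fF) (thompson0 gF) (thompson1 fF) (thompson1 gF).
    by case: bij.
- have [_ _ [s [sd sP]] _] := gF; have [_ _ [r [rd /(thompson_piece fF) rP]] _] := fF.
  have [s' [s'd s'P]] : exists s' : seq R, (forall b, b \in s' -> dyadic b) /\
      forall x, 0 <= x <= 1 -> f x \in s -> x \in s'.
    elim: s sd {sP} => [_|b s IH sd]; first by exists [::].
    have [|s' [s'd s'P]] := IH; first by move=> c cs; apply: sd; rewrite inE cs orbT.
    have [/thompson_surj-/(_ _ fF)[x x01 fx]|nb] := boolP (0 <= b <= 1%:R).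
    + exists (x :: s'); split=> [c|y y01].
      * rewrite inE => /predU1P[->|/s'd//].
        by apply: (thompson_dyadic fF x01); rewrite fx; apply: sd; rewrite mem_head.
      * rewrite !inE -fx => /predU1P[fxy|/(s'P _ y01)->]; last by rewrite orbT.
        by rewrite [X in X || _](_ : _ = true)//; apply/eqP;
          apply: (thompson_inj fF).
    + exists s'; split=> // y y01; rewrite inE => /predU1P[fy|/(s'P _ y01)//].
      by move: nb; rewrite -fy fb.
  exists (s' ++ r); split=> [b|a b a0 ab b1 nb].
    by rewrite mem_cat => /orP[/s'd|/rd].
  have b0 : 0 <= b by exact: le_trans a0 (ltW ab).
  have a1 : a <= 1 by exact: le_trans (ltW ab) b1.
  have [|k [c fE]] := rP a b a0 ab b1.
    by move=> x /nb; rewrite mem_cat negb_or => /andP[].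
  have /andP[fa0 fa1] : 0 <= f a <= 1 by apply: fb; rewrite a0.
  have /andP[fb0 fb1] : 0 <= f b <= 1 by apply: fb; rewrite b0.
  have [|k' [c' gE]] := sP (f a) (f b) fa0 (thompson_incr fF a0 ab b1) fb1.
    move=> y /andP[fay yfb]; apply/negP => ys.
    have [|x x01 fx] := thompson_surj fF (y := y).
      by rewrite (le_trans fa0 (ltW fay)) (le_trans (ltW yfb) fb1).
    have /andP[x0 x1] := x01.
    have axb : a < x < b.
      by apply/andP; split; rewrite -(thompson_lt fF)// fx.
    have := nb _ axb; rewrite mem_cat negb_or => /andP[/negP + _]; apply.
    by apply: s'P => //; rewrite fx.
  exists (k' + k), (2 ^ k' * c + c') => x /andP[ax xb].
  have x0 : 0 <= x by exact: le_trans a0 (ltW ax).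
  have x1 : x <= 1 by exact: le_trans (ltW xb) b1.
  rewrite /= gE; last by rewrite !(thompson_lt fF)// ax.
  by rewrite fE ?(ltW ax) ?(ltW xb)// expfzDr ?pnatr_eq0//; ring.
- by move=> x nx; rewrite /=; have [_ _ _ ->//] := fF; exact: thompson0 gF.
Qed.

Definition id01 : R -> R := fun x => if x \in `[0, 1] then x else 0.

Lemma thompson_id01 : thompson_like 1 id01.
Proof.
have idE x : 0 <= x <= 1 -> id01 x = x by rewrite /id01 in_itv/= => ->.
split.
- split=> [x|x y|y] /=; rewrite ?inE /= ?in_itv/=.
  + by move=> x01; rewrite idE.
  + by move=> /idE-> /idE->.
  + by move=> y01; exists y; rewrite /= ?in_itv//= idE.
- have c0 : {within `[0, 1], continuous (idfun : R -> R)}.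
    by apply: continuous_subspaceT => x; exact: cvg_id.
  apply: subspace_eq_continuous c0 => x.
  by rewrite inE/= in_itv/= => /idE.
- exists [::]; split=> // a b a0 ab b1 _; exists 0, 0 => x /andP[ax xb].
  rewrite expr0z mul1r addr0 idE// (le_trans a0 (ltW ax))/=.
  exact: le_trans (ltW xb) b1.
- by move=> x /negbTE; rewrite /id01 => ->.
Qed.

Definition thompson_one : thompson 1 := Thompson thompson_id01.

Definition thompson_rcomp n (x : thompson n) (f : thompson 1) : thompson n :=
  Thompson (thompson_comp (thompson_funP x) (thompson_funP f)).

(* The map s_{n,J} on [0,n]; the j-th summand is 0 on [0,j], has slope 1 on
   [j,j+1], and is 1 on [j+1,n]. Ordinals start at 0, so j : 'I_n stands for
   the element j+1 of {1,...,n} and for the interval [j,j+1]. *)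
Definition stretch n (J : {set 'I_n}) (x : R) : R :=
  x + \sum_(j in J) Num.min 1 (Num.max 0 (x - j%:R)).

Lemma stretchE n (J : {set 'I_n}) (i : 'I_n) (x : R) :
  i%:R <= x <= i.+1%:R ->
  stretch J x = stretch J i%:R + (if i \in J then 2 else 1) * (x - i%:R).
Proof.
rewrite -natr1 => /andP[ix xi1]; rewrite /stretch.
have H (j : 'I_n) : Num.min 1 (Num.max 0 (x - j%:R)) =
    Num.min 1 (Num.max 0 (i%:R - j%:R)) + (if j == i then x - i%:R else 0).
  case: (ltngtP j i) => [ji|ij|/val_inj ->]; last 1 first.
  - rewrite eqxx subrr maxxx (min_r ler01) add0r max_r ?subr_ge0// min_r//.
    by rewrite lerBlDl.
  - have : (j%:R + 1 <= i%:R :> R) by rewrite natr1 ler_nat.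
    rewrite -val_eqE/= (ltn_eqF ji) addr0 => ji1.
    by rewrite !max_r ?min_l//; lra.
  - have : (i%:R + 1 <= j%:R :> R) by rewrite natr1 ler_nat.
    rewrite -val_eqE/= (gtn_eqF ij) addr0 => ij1.
    by rewrite !max_l//; lra.
under eq_bigr do rewrite H.
rewrite big_split/= -big_mkcondr/=.
set S := \sum_(j in J) _.
case: ifPn => iJ.
- rewrite [X in _ + (_ + X)](_ : _ = x - i%:R); first by ring.
  rewrite (big_pred1 i) => [//|j] /=; case: eqP => [->|_]; by rewrite ?iJ ?andbF.
- rewrite [X in _ + (_ + X)]big_pred0 => [|j]; first by ring.
  by case: eqP => [->|]; rewrite ?(negbTE iJ) ?andbF.
Qed.

(* The label g[J] of the vertex of C(g) given by J. *)
Definition vertex_label n (g : thompson n) (J : {set 'I_n}) : R -> R :=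
  stretch J \o g.

Definition in_cube n (t : 'rV[R]_n) : Prop := forall i, 0 <= t ord0 i <= 1.

Definition char_vec n (J : {set 'I_n}) : 'rV[R]_n := \row_i (i \in J)%:R.

Definition between n (A B J : {set 'I_n}) : bool :=
  (A \subset J) && (J \subset B).

(* The face of [0,1]^n whose vertices are the [char_vec J], [between A B J]. *)
Definition in_face n (A B : {set 'I_n}) (t : 'rV[R]_n) : Prop :=
  [/\ in_cube t, forall i, i \in A -> t ord0 i = 1
    & forall i, i \notin B -> t ord0 i = 0].

(* A point of the disjoint union of the cubes C(g). *)
Record cube_point := CubePoint {
  cp_dim : nat;
  cp_cube : thompson cp_dim;
  cp_coord : 'rV[R]_cp_dim;
  cp_coordP : in_cube cp_coord }.

(* A face of C(g) and a face of C(h) with the same labels are identified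
   through the affine map t |-> t M + v which preserves labels of vertices. *)
Definition glued_coord n m (g : thompson n) (h : thompson m)
    (t : 'rV[R]_n) (u : 'rV[R]_m) : Prop :=
  exists (A B : {set 'I_n}) (A' B' : {set 'I_m})
         (M : 'M[R]_(n, m)) (v : 'rV[R]_m),
    [/\ A \subset B /\ A' \subset B',
        forall J, between A B J -> exists J', [/\ between A' B' J',
          char_vec J *m M + v = char_vec J' & vertex_label g J = vertex_label h J'],
        forall J', between A' B' J' -> exists J, [/\ between A B J,
          char_vec J *m M + v = char_vec J' & vertex_label g J = vertex_label h J'],
        in_face A B t
      & u = t *m M + v].

Definition glued (p q : cube_point) : Prop :=
  glued_coord (cp_cube p) (cp_cube q) (cp_coord p) (cp_coord q).

HB.instance Definition _ := gen_eqMixin cube_point.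
HB.instance Definition _ := gen_choiceMixin cube_point.

Definition identified (p q : cube_point) : bool :=
  `[< clos_refl_sym_trans cube_point glued p q >].

Lemma identified_refl : reflexive identified.
Proof. by move=> p; apply/asboolP; exact: rst_refl. Qed.

Lemma identified_sym : symmetric identified.
Proof. by move=> p q; apply/asboolP/asboolP; exact: rst_sym. Qed.

Lemma identified_trans : transitive identified.
Proof.
by move=> q p r /asboolP pq /asboolP qr; apply/asboolP; exact: rst_trans pq qr.
Qed.

Canonical identified_equiv :=
  EquivRel identified identified_refl identified_sym identified_trans.

Definition X : Type := {eq_quot identified}.

Definition to_X (p : cube_point) : X := \pi_({eq_quot identified}) p.

Definition euclidean_dist n (t u : 'rV[R]_n) : R :=
  Num.sqrt (\sum_(i < n) (t ord0 i - u ord0 i) ^+ 2).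

(* [string_length x y l]: there is a finite sequence of points of X from x to
   y, any two consecutive ones lying in a common cube, with total length l. *)
Inductive string_length : X -> X -> R -> Prop :=
| string_nil x : string_length x x 0
| string_cons n (g : thompson n) (t u : 'rV[R]_n)
    (tP : in_cube t) (uP : in_cube u) (y : X) (l : R) :
    string_length (to_X (CubePoint g uP)) y l ->
    string_length (to_X (CubePoint g tP)) y (euclidean_dist t u + l).

(* The intrinsic length metric, with values in the extended reals. *)
Definition dist (x y : X) : \bar R :=
  ereal_inf [set l%:E | l in [set l | string_length x y l]].

Definition act_point (f : thompson 1) (p : cube_point) : cube_point :=
  CubePoint (thompson_rcomp (cp_cube p) f) (@cp_coordP p).

Definition act (f : thompson 1) (x : X) : X :=
  to_X (act_point f (repr (x : {eq_quot identified}))).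

Lemma act_to_X f p : act f (to_X p) = to_X (act_point f p).
Proof.
rewrite /act /to_X; case: piP => q /eqmodP /asboolP pq; apply/eqmodP/asboolP.
apply: rst_sym; elim: pq => {p q} [p q|p|p q _|p q r _ pq _].
- move=> [A [B [A' [B' [M [v [AB H H' tAB uE]]]]]]]; apply: rst_step.
  have lab n m (g : thompson n) (h : thompson m) J J' :
      vertex_label g J = vertex_label h J' ->
      vertex_label (thompson_rcomp g f) J = vertex_label (thompson_rcomp h f) J'.
    by move=> E; apply/funext => x; exact: (congr1 (fun k => k (f x)) E).
  exists A, B, A', B', M, v; split=> //.
  + by move=> J /H[J' [? ? /lab ?]]; exists J'.
  + by move=> J' /H'[J [? ? /lab ?]]; exists J.
- exact: rst_refl.
- exact: rst_sym.
- exact: rst_trans.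
Qed.

Definition is_isometry (phi : X -> X) : Prop :=
  bijective phi /\ forall x y, dist (phi x) (phi y) = dist x y.

Definition translation_length (phi : X -> X) : \bar R :=
  ereal_inf (range (fun x => dist (phi x) x)).

Definition is_ballistic (phi : X -> X) : Prop :=
  (0 < translation_length phi)%E.

End ThompsonLike.

Arguments thompson R n : clear implicits.
Arguments thompson_one R : clear implicits.
Arguments X R : clear implicits.

(* Main.v *)
(* For a point p and a direction d, the function g |-> log2 (slope of g at p in
   direction d) on the vertices of X extends affinely to each cube C(g): replacing
   g by g[J] adds 1 exactly when the piece of g at the germ (p, d) lies in J, so
   the extension is a constant plus one coordinate. Labels determine it, hence it
   descends to X.
   Let f <> 1, say f x < x (otherwise use the inverse of f), and let p < x < q be
   the nearest fixed points. Then f has slope < 1 at p from the right and slope > 1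
   at q from the left. The height at (q, -) minus the height at (p, +) is on each
   cube either constant or a constant plus a difference of two distinct coordinates,
   hence sqrt 2-Lipschitz, and f increases it by at least 2. So f moves every point
   by at least 2 / sqrt 2.
   The bound is attained: the generator x_0 maps one of two opposite corners of the
   square C(2x) to the other. *)
Require Import Defs.
From mathcomp Require Import all_boot all_order all_algebra.
From mathcomp Require Import all_classical all_reals all_analysis.
From mathcomp Require Import zify ring lra generic_quotient.

Import Order.TTheory GRing.Theory Num.Theory.
Import numFieldNormedType.Exports.
Local Open Scope ring_scope.

Set Implicit Arguments.
Unset Strict Implicit.
Unset Printing Implicit Defensive.

(** * Inverses in Thompson's group and the isometric action *)

Section Inverse.
Context {R : realType}.
Implicit Types (g f : R -> R) (x y : R).

Lemma thompson_eq n (g h : thompson R n) :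
  (forall x, 0 <= x <= 1 -> g x = h x) -> g = h.
Proof.
move=> gh; have : thompson_fun g = thompson_fun h.
  apply/funext => x; have [x01|x01] := boolP (x \in `[0, 1]).
    by apply: gh; move: x01; rewrite in_itv.
  have [_ _ _ g0] := thompson_funP g; have [_ _ _ h0] := thompson_funP h.
  by rewrite g0// h0.
case: g h {gh} => [g gP] [h hP] /= gh; case: _ / gh in hP *.
by rewrite (Prop_irrelevance gP hP).
Qed.

(** Needed for inverses, whose breaking points are the images of those of the original map.
    Dyadicity propagates from left to right through the affine pieces. *)
Lemma dyadic_thompson n g : thompson_like n g ->
  forall x, dyadic x -> dyadic (g x).
Proof.
move=> gF; have [_ _ [s [sd /(thompson_piece gF) sP]] gout] := gF.
have [d0 d1] : dyadic (0 : R) /\ dyadic (1 : R).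
  by split; [exists 0, 0%N|exists 1, 0%N]; rewrite ?mul0r// divr1.
suff H : forall x y, 0 <= x -> x < y -> y <= 1 -> dyadic x -> dyadic (g x) ->
    forall z, x <= z <= y -> dyadic z -> dyadic (g z).
  move=> x dx; have [|/gout->//] := boolP (x \in `[0, 1]).
  rewrite in_itv/= => x01; apply: (H 0 1) => //.
  by rewrite (thompson0 gF).
apply: (@subdivision_ind _ s) => [x y x0 xy y1 nb dx dgx z xzy dz|x b y].
- have [k [c gE]] := sP x y x0 xy y1 nb.
  have -> : g z = g x + 2 ^ k * (z - x).
    by rewrite !gE ?lexx ?(ltW xy)//; ring.
  by apply: dyadicD => //; apply/dyadic_exprz/dyadicD => //; apply: dyadicN.
- move=> x0 xb yb y1 bs Pxb Pby dx dgx z /andP[xz zy] dz.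
  have [zb|bz] := leP z b; first by apply: Pxb => //; rewrite xz.
  apply: Pby; rewrite ?(ltW bz) ?zy//; first exact: sd.
  by apply: (Pxb dx dgx b _); rewrite ?lexx ?(ltW xb)//; exact: sd.
Qed.

Lemma thompson_continuous n g :
  (forall x y, 0 <= x -> x < y -> y <= 1 -> g x < g y) ->
  set_surj `[0, 1] `[0, n%:R] g -> g 0 = 0 -> g 1 = n%:R ->
  {within `[0, 1], continuous g}%classic.
Proof.
move=> incr gs g0 g1; apply: segment_inc_surj_continuous.
- move=> x y; rewrite !in_itv/= => /andP[x0 x1] /andP[y0 y1].
  have [xy|yx|->] := ltgtP x y; last by rewrite lexx.
  + by rewrite ltW// incr.
  + by apply/negbTE; rewrite -ltNge incr.
- by rewrite g0 g1.
Qed.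

Lemma thompson_inverse f : thompson_like 1 f ->
  exists2 h, thompson_like 1 h &
    forall x, 0 <= x <= 1 -> [/\ 0 <= h x <= 1, f (h x) = x & h (f x) = x].
Proof.
move=> fF; have fb x : 0 <= x <= 1 -> 0 <= f x <= 1 := thompson_bound fF (x := x).
(* The value 0 outside the unit interval follows the convention for representing functions on it. *)
have hex x : exists y, if 0 <= x <= 1 then 0 <= y <= 1 /\ f y = x else y = 0.
  have [x01|_] := boolP (0 <= x <= 1); last by exists 0.
  by have [y] := thompson_surj fF (y := x) x01; exists y.
pose h x := sval (cid (hex x)).
have hP x : 0 <= x <= 1 -> 0 <= h x <= 1 /\ f (h x) = x.
  by move=> x01; rewrite /h; case: cid => y /=; rewrite x01.
have hK x : 0 <= x <= 1 -> h (f x) = x.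
  move=> x01; have [b e] := hP _ (fb _ x01).
  exact: (thompson_inj fF) b x01 e.
have h0 : h 0 = 0 by rewrite -{1}(thompson0 fF) hK// lexx ler01.
have h1 : h 1 = 1 by rewrite -{1}[1](thompson1 fF) hK// lexx ler01.
have incr x y : 0 <= x -> x < y -> y <= 1 -> h x < h y.
  move=> x0 xy y1.
  have x01 : 0 <= x <= 1 by rewrite x0 (le_trans (ltW xy)).
  have y01 : 0 <= y <= 1 by rewrite y1 (le_trans x0 (ltW xy)).
  have [/andP[a b] e] := hP _ x01; have [/andP[a' b'] e'] := hP _ y01.
  by rewrite -(thompson_lt fF)// e e'.
have bij : set_bij `[0, 1]%classic `[0, 1]%classic h.
  split=> [x|x y|y] /=; rewrite ?inE /= ?in_itv/=.
  + by move=> /hP[].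
  + by move=> /hP[_ {2}<-] /hP[_ {2}<-] ->.
  + by move=> y01; exists (f y); rewrite /= ?in_itv/= ?fb ?hK.
exists h; last by move=> x x01; have [? ?] := hP x x01; split=> //; exact: hK.
split=> //.
- by apply: (@thompson_continuous 1) => //; case: bij.
- have [_ _ [s [sd /(thompson_piece fF) sP]] _] := fF.
  exists (map f s); split=> [b /mapP[x /sd xd ->]|a b a0 ab b1 nb].
    exact: dyadic_thompson fF _ xd.
  have b0 : 0 <= b by exact: le_trans a0 (ltW ab).
  have a1 : a <= 1 by exact: le_trans (ltW ab) b1.
  have [/andP[ha0 ha1] fa] : 0 <= h a <= 1 /\ f (h a) = a by apply: hP; rewrite a0.
  have [/andP[hb0 hb1] fhb] : 0 <= h b <= 1 /\ f (h b) = b by apply: hP; rewrite b0.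
  have [|k [c fE]] := sP (h a) (h b) ha0 (incr _ _ a0 ab b1) hb1.
    move=> x /andP[ax xb]; have x0 := le_trans ha0 (ltW ax).
    have x1 := le_trans (ltW xb) hb1.
    suff : f x \notin map f s by apply: contra; exact: map_f.
    by apply: nb; apply/andP; split;
      [rewrite -[X in X < _]fa|rewrite -[X in _ < X]fhb]; rewrite (thompson_lt fF).
  (* Obtained by solving [x = 2 ^ k * h x + c] for [h x]. *)
  exists (- k), (- (2 ^ (- k) * c)) => x /andP[ax xb].
  have x0 := le_trans a0 (ltW ax); have x1 := le_trans (ltW xb) b1.
  have [_ fx] : 0 <= h x <= 1 /\ f (h x) = x by apply: hP; rewrite x0.
  have := fE (h x); rewrite fx !ltW ?incr// => /(_ isT) {2}->.
  rewrite mulrDr mulrA -expfzDr ?pnatr_eq0// addNr expr0z.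
  by ring.
- move=> x; rewrite in_itv/= => x01; rewrite /h; case: cid => y /=.
  by rewrite (negbTE x01).
Qed.

Lemma thompson_inverse_elt (f : thompson R 1) : exists h : thompson R 1,
  (forall x, 0 <= x <= 1 -> [/\ 0 <= h x <= 1, f (h x) = x & h (f x) = x]).
Proof. by have [h hF hP] := thompson_inverse (thompson_funP f); exists (Thompson hF). Qed.

(** Acting by [f] and then by [h] replaces [g] by [g \o f \o h]: precomposition reverses the order,
    so a right inverse of [f] acts as a left inverse. *)
Lemma act_cancel (f h : thompson R 1) : (forall x, 0 <= x <= 1 -> f (h x) = x) ->
  cancel (act f) (act h).
Proof.
move=> fh x; rewrite -[x]reprK -/(to_X (repr x)) !act_to_X; congr to_X.
case: (repr x) => n g t tP; rewrite /act_point /=.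
suff -> : thompson_rcomp (thompson_rcomp g f) h = g by [].
by apply: thompson_eq => y y01 /=; rewrite fh.
Qed.

Lemma string_length_act (f : thompson R 1) (x y : X R) l :
  string_length x y l -> string_length (act f x) (act f y) l.
Proof.
elim=> {x y l} [x|n g t u tP uP y l _]; first exact: string_nil.
by rewrite !act_to_X; exact: string_cons.
Qed.

(** Both [f] and its inverse carry strings to strings of equal length, so the two distances are
    infima of the same set of lengths. *)
Lemma act_is_isometry (f : thompson R 1) : is_isometry (act f).
Proof.
have [h hP] := thompson_inverse_elt f.
have fK : cancel (act f) (act h) by apply: act_cancel => x /hP[].
have hK : cancel (act h) (act f) by apply: act_cancel => x /hP[].
split=> [|x y]; first by exists (act h).
rewrite /dist; congr ereal_inf; congr image.
apply/seteqP; split=> l /=; last exact: string_length_act.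
by move=> /(string_length_act h); rewrite !fK.
Qed.

End Inverse.

(** * One-sided germs and the height functions they define *)

Section Germs.
Context {R : realType}.
Implicit Types (g f : R -> R) (p d : R).

Definition inward p d := d = 1 /\ 0 <= p < 1 \/ d = -1 /\ 0 < p <= 1.

(** Here [k] is the binary logarithm of the slope on the side [d] of [p], and [s] is the distance
    from [p]. *)
Definition germ_slope g p d (k : int) := exists2 e : R, 0 < e &
  forall s, 0 <= s <= e -> g (p + d * s) = g p + d * 2 ^ k * s.

(* Closed bounds: a germ at a point with integer image still determines its
   piece, because an affine germ of nonzero slope is not constant. *)
Definition germ_piece g p d (i : nat) := exists2 e : R, 0 < e &
  forall s, 0 <= s <= e -> i%:R <= g (p + d * s) <= i.+1%:R.

Lemma inward_neq0 p d : inward p d -> d != 0.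
Proof. by move=> [[-> _]|[-> _]]; rewrite ?oppr_eq0 oner_eq0. Qed.

Lemma avoid_seq (s : seq R) p d : d != 0 ->
  exists2 e : R, 0 < e & forall x, 0 < x < e -> p + d * x \notin s.
Proof.
move=> d0; elim: s => [|b s [e e0 IH]]; first by exists 1.
(* The ray from [p] hits [b] at the parameter [(b - p) / d]; only a positive one shortens the
   range. *)
have [c0|c0] := ltP 0 ((b - p) / d).
- exists (Num.min e ((b - p) / d)) => [|x].
    by rewrite lt_min e0.
  rewrite lt_min => /and3P[x0 xe xb]; rewrite inE negb_or IH ?x0// andbT.
  by apply: contraTneq xb => <-; rewrite addrAC subrr add0r mulrAC divff// mul1r ltxx.
- exists e => // x /andP[x0 xe]; rewrite inE negb_or IH ?x0// andbT.
  apply: contraTneq x0 => E; rewrite -leNgt (le_trans _ c0)//.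
  by rewrite -E addrAC subrr add0r mulrAC divff// mul1r.
Qed.

Lemma germ_slope_ex n g p d : thompson_like n g -> inward p d ->
  exists k, germ_slope g p d k.
Proof.
move=> gF pd; have [_ _ [s [sd /(thompson_piece gF) sP]] _] := gF.
have [e e0 es] := avoid_seq s p (inward_neq0 pd).
case: pd => -[dE /andP[p0 p1]]; rewrite {}dE in es *.
- pose b := Num.min (p + e) 1.
  have pb : p < b by rewrite lt_min p1 ltrDl e0.
  have b1 : b <= 1 by rewrite ge_min lexx orbT.
  have be : b <= p + e by rewrite ge_min lexx.
  have [|k [c gE]] := sP p b p0 pb b1.
    move=> x /andP[px xb]; have -> : x = p + 1 * (x - p) by ring.
    by apply: es; lra.
  exists k, (b - p) => [|s' s'P]; first by rewrite subr_gt0.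
  by rewrite !gE ?lexx ?(ltW pb)//; [ring|lra].
- pose a := Num.max (p - e) 0.
  have ap : a < p by rewrite gt_max p0 ltrBlDr ltrDl e0.
  have a0 : 0 <= a by rewrite le_max lexx orbT.
  have ae : p - e <= a by rewrite le_max lexx.
  have [|k [c gE]] := sP a p a0 ap p1.
    move=> x /andP[px xb]; have -> : x = p + -1 * (p - x) by ring.
    by apply: es; lra.
  exists k, (p - a) => [|s' s'P]; first by rewrite subr_gt0.
  by rewrite !gE ?lexx ?(ltW ap)//; [ring|lra].
Qed.

Lemma germ_slope_uniq g p d k k' : d != 0 ->
  germ_slope g p d k -> germ_slope g p d k' -> k = k'.
Proof.
move=> d0 [e e0 gE] [e' e'0 gE'].
pose s := Num.min e e'.
have s0 : 0 < s by rewrite lt_min e0.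
have := gE s; rewrite gE' ?ge_min ?lexx ?(ltW s0) ?orbT// => /(_ isT).
move=> /addrI /(mulIf (lt0r_neq0 s0)) /(mulfI d0) E.
have i2 : injective (fun z : int => (2 : R) ^ z).
  by apply: ieexprIz; rewrite ?ltr0n// (eqr_nat R 2 1).
exact: i2 (esym E).
Qed.

Lemma germ_piece_uniq n g p d i j : thompson_like n g -> inward p d ->
  germ_piece g p d i -> germ_piece g p d j -> i = j.
Proof.
move=> gF pd; wlog ij : i j / (i < j)%N => [H gi gj|].
  by have [/H->//|/H<-//|//] := ltngtP i j.
have [k [e e0 gE]] := germ_slope_ex gF pd.
move=> [e1 e10 gi] [e2 e20 gj]; exfalso.
pose s := Num.min e (Num.min e1 e2).
have s0 : 0 < s by rewrite !lt_min e0 e10.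
have [se se1 se2] : [/\ s <= e, s <= e1 & s <= e2] by rewrite !ge_min !lexx !orbT.
have ij' : (i.+1%:R <= j%:R :> R) by rewrite ler_nat.
(* The upper bound of piece [i] and the lower bound of piece [j] squeeze [g] to the constant [j],
   against its nonzero slope. *)
have E x : 0 <= x <= s -> g (p + d * x) = j%:R.
  move=> x0s; have /andP[_ a] : i%:R <= g (p + d * x) <= i.+1%:R by apply: gi; lra.
  have /andP[b _] : j%:R <= g (p + d * x) <= j.+1%:R by apply: gj; lra.
  by apply/eqP; rewrite eq_le b (le_trans a).
have E0 : g p = j%:R by rewrite -(E 0) ?mulr0 ?addr0// lexx ltW.
have : g (p + d * s) = g p + d * 2 ^ k * s by apply: gE; rewrite ltW.
rewrite E ?(ltW s0) ?lexx// E0 -[LHS]addr0 => /addrI /esym/eqP.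
by rewrite !mulf_eq0 (negbTE (inward_neq0 pd)) gt_eqF ?exprz_gt0// gt_eqF.
Qed.

Lemma germ_piece_ex n g p d : thompson_like n g -> inward p d ->
  exists i : 'I_n, germ_piece g p d i.
Proof.
move=> gF pd; have [k [e e0 gE]] := germ_slope_ex gF pd.
have k0 : 0 < (2 : R) ^ k by rewrite exprz_gt0.
case: pd => -[dE /andP[p0 p1]]; rewrite {}dE in gE *.
- have /andP[v0 _] : 0 <= g p <= n%:R by apply: (thompson_bound gF); rewrite p0 ltW.
  have /andP[iv vi] := truncn_itv v0; set i := Num.truncn _ in iv vi.
  have vn : g p < n%:R by rewrite -(thompson1 gF) (thompson_lt gF)// ltW.
  have ilt : (i < n)%N by rewrite -(ltr_nat R) (le_lt_trans iv).
  exists (Ordinal ilt), (Num.min e ((i.+1%:R - g p) / 2 ^ k)) => [|s].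
    by rewrite lt_min e0 divr_gt0// subr_gt0.
  rewrite le_min ler_pdivlMr// => /and3P[s0 se sv]; rewrite gE ?s0//= mul1r.
  by have := mulr_ge0 (ltW k0) s0; lra.
- have /andP[v0 vn] : 0 <= g p <= n%:R by apply: (thompson_bound gF); rewrite p1 ltW.
  have v0' : 0 < g p by rewrite -(thompson0 gF) (thompson_lt gF)// ltW.
  (* Leftwards, an integer value belongs to the piece below it, so the index is the ceiling of [g p]
     minus 1. *)
  have [i iv vi] : exists2 i : nat, i%:R < g p & g p <= i.+1%:R.
    have /andP[] := truncn_itv v0; set i := Num.truncn _.
    rewrite le_eqVlt => /predU1P[iE _|iv vi]; last by exists i => //; exact: ltW.
    case: i iE => [E|i <-]; first by move: v0'; rewrite -E ltxx.
    by exists i; rewrite ?ltr_nat.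
  have ilt : (i < n)%N by rewrite -(ltr_nat R) (lt_le_trans iv).
  exists (Ordinal ilt), (Num.min e ((g p - i%:R) / 2 ^ k)) => [|s].
    by rewrite lt_min e0 divr_gt0// subr_gt0.
  rewrite le_min ler_pdivlMr// => /and3P[s0 se sv]; rewrite gE ?s0//=.
  by have := mulr_ge0 (ltW k0) s0; lra.
Qed.

Lemma germ_slope_stretch n g p d k (i : 'I_n) (J : {set 'I_n}) :
  germ_slope g p d k -> germ_piece g p d i ->
  germ_slope (stretch J \o g) p d (k + (i \in J)%:Z).
Proof.
move=> [e e0 gE] [e' e'0 gi]; exists (Num.min e e') => [|s].
  by rewrite lt_min e0.
rewrite le_min => /and3P[s0 se se'] /=.
(* The base point and the moved point lie in the same closed piece, where [stretch J] is affine of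
   slope 2 or 1. *)
have gpi : i%:R <= g p <= i.+1%:R.
  by have := gi 0; rewrite mulr0 addr0; apply; rewrite lexx ltW.
rewrite (stretchE _ (gi s _)) ?s0// (stretchE _ gpi) gE ?s0//.
rewrite expfzDr ?pnatr_eq0//.
by case: (i \in J); rewrite ?expr1z ?expr0z; ring.
Qed.

(** The chain rule in logarithmic form: [f] fixes [p] and preserves sides, so only the germ of [g]
    at [p] itself enters. *)
Lemma germ_slope_comp g f p d k k' : f p = p ->
  germ_slope f p d k' -> germ_slope g p d k -> germ_slope (g \o f) p d (k + k').
Proof.
move=> fp [e e0 fE] [e' e'0 gE].
have k0 : 0 < (2 : R) ^ k' by rewrite exprz_gt0.
exists (Num.min e (e' / 2 ^ k')) => [|s]; first by rewrite lt_min e0 divr_gt0.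
rewrite le_min ler_pdivlMr// => /and3P[s0 se se'] /=.
rewrite fE ?s0// fp -mulrA gE.
  by rewrite expfzDr ?pnatr_eq0//; ring.
by rewrite mulr_ge0 ?(ltW k0)// mulrC.
Qed.

Lemma germ_piece_comp g f p d k' i : f p = p ->
  germ_slope f p d k' -> germ_piece g p d i -> germ_piece (g \o f) p d i.
Proof.
move=> fp [e e0 fE] [e' e'0 gE].
have k0 : 0 < (2 : R) ^ k' by rewrite exprz_gt0.
exists (Num.min e (e' / 2 ^ k')) => [|s]; first by rewrite lt_min e0 divr_gt0.
rewrite le_min ler_pdivlMr// => /and3P[s0 se se'] /=.
rewrite fE ?s0// fp -mulrA gE//.
by rewrite mulr_ge0 ?(ltW k0)// mulrC.
Qed.

(* The affine extension to the cube C(g) of the function sending a vertex to the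
   binary logarithm of the slope of its label at p in direction d. *)
Definition height p d n g (t : 'rV[R]_n) : R :=
  (xget 0 [set k | germ_slope g p d k])%:~R +
  \sum_(i < n | `[< germ_piece g p d i >]) t ord0 i.

Lemma heightE p d n g (t : 'rV[R]_n) k (i : 'I_n) : thompson_like n g ->
  inward p d -> germ_slope g p d k -> germ_piece g p d i ->
  height p d g t = k%:~R + t ord0 i.
Proof.
move=> gF pd gk gi; rewrite /height; congr (_%:~R + _).
  case: xgetP => [k' _ /= gk'|/(_ k)//].
  exact: germ_slope_uniq (inward_neq0 pd) gk' gk.
rewrite (big_pred1 i)// => j; apply/asboolP/eqP => [gj|->//].
by apply/val_inj/(germ_piece_uniq gF pd gj gi).
Qed.

(** At a vertex the height is the logarithm of the slope of the label itself, by
    [germ_slope_stretch], and that exponent is unique. *)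
Lemma height_vertexE p d n m (g : thompson R n) (h : thompson R m) J J' :
  inward p d -> vertex_label g J = vertex_label h J' ->
  height p d g (char_vec J) = height p d h (char_vec J').
Proof.
move=> pd gh; have [gF hF] := (thompson_funP g, thompson_funP h).
have [k gk] := germ_slope_ex gF pd; have [k' hk'] := germ_slope_ex hF pd.
have [i gi] := germ_piece_ex gF pd; have [i' hi'] := germ_piece_ex hF pd.
rewrite (heightE _ gF pd gk gi) (heightE _ hF pd hk' hi').
have := germ_slope_stretch J gk gi.
rewrite -/(vertex_label g J) gh => E.
have := germ_slope_stretch J' hk' hi'.
move=> /(germ_slope_uniq (inward_neq0 pd) E) /(congr1 (intmul (1 : R))).
by rewrite !rmorphD /char_vec !mxE.
Qed.

(** The vertex [A] gives the value 0, and passing from [A] to [i |: A] gives [w i = 0] for each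
    coordinate [i] free on the face; the fixed coordinates contribute as they do at [A]. *)
Lemma affine_face_eq0 n (A B : {set 'I_n}) (c : R) (w : 'I_n -> R) :
  A \subset B ->
  (forall J, between A B J -> c + \sum_i (char_vec J) ord0 i * w i = 0) ->
  forall t, in_face A B t -> c + \sum_i t ord0 i * w i = 0.
Proof.
move=> AB H t [_ tA tB].
have charE J : \sum_i (char_vec J) ord0 i * w i = \sum_(i in J) w i.
  rewrite [RHS]big_mkcond; apply: eq_bigr => i _; rewrite mxE.
  by case: (i \in J); rewrite ?mul1r ?mul0r.
have HA : c + \sum_(i in A) w i = 0.
  by rewrite -charE; apply: H; rewrite /between subxx.
have w0 i : i \in B -> i \notin A -> w i = 0.
  move=> iB iA; have := H (i |: A).
  rewrite charE big_setU1//= addrCA HA addr0; apply.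
  by rewrite /between finset.subsetUr finset.subUset finset.sub1set iB.
rewrite -[RHS]HA [in RHS]big_mkcond; congr (_ + _); apply: eq_bigr => i _.
have [iA|iA] := boolP (i \in A); first by rewrite tA ?mul1r.
by have [iB|iB] := boolP (i \in B); [rewrite w0 ?mulr0|rewrite tB ?mul0r].
Qed.

Lemma height_glued p d (a b : cube_point) : inward p d -> glued a b ->
  height p d (cp_cube a) (cp_coord a) = height p d (cp_cube b) (cp_coord b).
Proof.
move=> pd; case: a b => [n g t tP] [m h u uP] /=.
move=> [A [B [A' [B' [M [v [[AB _] H _ tAB uE]]]]]]].
move: uE tAB => /= -> /= tAB.
have [gF hF] := (thompson_funP g, thompson_funP h).
have [k gk] := germ_slope_ex gF pd; have [k' hk'] := germ_slope_ex hF pd.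
have [i gi] := germ_piece_ex gF pd; have [i' hi'] := germ_piece_ex hF pd.
(* Along the gluing map the difference of the two heights is affine in [r]; it vanishes at the
   vertices of the face because labels agree there. *)
have subE (r : 'rV_n) : height p d g r - height p d h (r *m M + v) =
    (k%:~R - k'%:~R - v ord0 i') + \sum_l r ord0 l * ((l == i)%:R - M l i').
  rewrite (heightE _ gF pd gk gi) (heightE _ hF pd hk' hi') !mxE.
  under [in RHS]eq_bigr do rewrite mulrBr.
  rewrite sumrB; have -> : \sum_l r ord0 l * (l == i)%:R = r ord0 i; last by ring.
  rewrite (bigD1 i)//= eqxx mulr1 big1 ?addr0// => l /negbTE->.
  by rewrite mulr0.
apply/eqP; rewrite -subr_eq0 subE; apply/eqP; apply: (affine_face_eq0 AB) tAB.
move=> J /H[J' [_ E lab]].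
by rewrite -subE E (height_vertexE pd lab) subrr.
Qed.

Lemma height_identified p d (a b : cube_point) : inward p d -> to_X a = to_X b ->
  height p d (cp_cube a) (cp_coord a) = height p d (cp_cube b) (cp_coord b).
Proof.
move=> pd /eqmodP /asboolP; elim=> {a b} [a b|//|a b _ ->//|a b c _ -> _ ->//].
exact: height_glued.
Qed.

Lemma height_act p d n (g : thompson R n) (f : thompson R 1) k (t : 'rV[R]_n) :
  inward p d -> f p = p -> germ_slope f p d k ->
  height p d (thompson_rcomp g f) t = height p d g t + k%:~R.
Proof.
move=> pd fp fk; have gF := thompson_funP g.
have [k' gk] := germ_slope_ex gF pd; have [i gi] := germ_piece_ex gF pd.
rewrite (heightE _ gF pd gk gi).
rewrite (heightE _ (thompson_funP (thompson_rcomp g f)) pd (germ_slope_comp fp fk gk)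
  (germ_piece_comp fp fk gi)) rmorphD.
by rewrite addrAC.
Qed.

End Germs.

(** * The lower bound on displacements *)

Section LowerBound.
Context {R : realType}.

(** A representative is chosen here; [height_gap_to_X] shows that the value does not depend on
    it. *)
Definition height_gap (p q : R) (x : X R) : R :=
  let c := repr x in
  height q (-1) (cp_cube c) (cp_coord c) - height p 1 (cp_cube c) (cp_coord c).

Lemma height_gap_to_X p q (c : cube_point) : 0 <= p < 1 -> 0 < q <= 1 ->
  height_gap p q (to_X c) =
  height q (-1) (cp_cube c) (cp_coord c) - height p 1 (cp_cube c) (cp_coord c).
Proof.
move=> p01 q01; have cE : to_X (repr (to_X c)) = to_X c by rewrite /to_X reprK.
have [pI qI] : inward p 1 /\ inward q (-1) by split; [left|right].
by rewrite /height_gap (height_identified pI cE) (height_identified qI cE).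
Qed.

Lemma euclidean_dist_ge2 n (t u : 'rV[R]_n) (i j : 'I_n) : i != j ->
  Num.sqrt ((t ord0 i - u ord0 i) ^+ 2 + (t ord0 j - u ord0 j) ^+ 2) <=
  euclidean_dist t u.
Proof.
move=> ij; rewrite ler_wsqrtr// (bigD1 i)//= lerD2l (bigD1 j) 1?eq_sym//=.
by rewrite lerDl sumr_ge0// => l _; exact: sqr_ge0.
Qed.

Lemma height_gap_lipschitz p q x y l : 0 <= p < 1 -> 0 < q <= 1 ->
  string_length x y l -> `|height_gap p q x - height_gap p q y| <= Num.sqrt 2 * l.
Proof.
move=> p01 q01; elim=> {x y l} [x|n g t u tP uP y l _ IH].
  by rewrite subrr normr0 mulr0.
apply: le_trans (ler_distD (height_gap p q (to_X (CubePoint g uP))) _ _) _.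
rewrite mulrDr lerD// !height_gap_to_X//=.
have [pI qI] : inward p 1 /\ inward q (-1) by split; [left|right].
have gF := thompson_funP g.
have [k gk] := germ_slope_ex gF pI; have [k' gk'] := germ_slope_ex gF qI.
have [i gi] := germ_piece_ex gF pI; have [j gj] := germ_piece_ex gF qI.
rewrite !(heightE _ gF pI gk gi) !(heightE _ gF qI gk' gj).
(* If both germs lie in the same piece, the two coordinates cancel and the gap is constant on the
   cube. *)
have [->|ij] := eqVneq i j.
  rewrite [X in `|X|](_ : _ = 0) ?normr0 ?mulr_ge0 ?sqrtr_ge0//; by ring.
apply: le_trans (ler_wpM2l (sqrtr_ge0 _) (euclidean_dist_ge2 t u ij)).
rewrite -sqrtrM ?ler0n// -sqrtr_sqr ler_wsqrtr//.
set a := t ord0 i; set b := u ord0 i; set c := t ord0 j; set e := u ord0 j.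
(* By the parallelogram identity this square is exactly the difference of the two sides. *)
have := sqr_ge0 ((a - b) + (c - e)); rewrite -subr_ge0 => H.
rewrite -subr_ge0; apply: le_trans H _; rewrite le_eqVlt; apply/orP; left.
by apply/eqP; ring.
Qed.

Lemma height_gap_act p q (f : thompson R 1) k k' x : 0 <= p < 1 -> 0 < q <= 1 ->
  f p = p -> f q = q -> germ_slope f p 1 k -> germ_slope f q (-1) k' ->
  height_gap p q (act f x) - height_gap p q x = k'%:~R - k%:~R.
Proof.
move=> p01 q01 fp fq fk fk'.
have [pI qI] : inward p 1 /\ inward q (-1) by split; [left|right].
rewrite -[x]reprK -/(to_X (repr x)) act_to_X !height_gap_to_X//=.
by rewrite (height_act _ _ pI fp fk) (height_act _ _ qI fq fk'); ring.
Qed.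

Lemma fixed_neighbours (f : thompson R 1) x : 0 <= x <= 1 -> f x < x ->
  exists p q, [/\ 0 <= p < x, x < q <= 1, f p = p, f q = q &
    forall y, p < y < q -> f y < y].
Proof.
move=> /andP[x0 x1] fx; have fF := thompson_funP f.
have f0 := thompson0 fF; have f1 := thompson1 fF.
(* With [y <= f y] in place of [f y = y], the inequality [f y < y] strictly between [sup S] and
   [inf T] is immediate; monotonicity of [f] then makes both ends fixed. *)
pose S := [set y : R | 0 <= y <= x /\ y <= f y]%classic.
pose T := [set y : R | x <= y <= 1 /\ y <= f y]%classic.
have S0 : S 0 by rewrite /S/= f0 !lexx.
have T1 : T 1 by rewrite /T/= f1 !lexx x1.
have Sub : has_ubound S by exists x => y [/andP[]].
have Tlb : has_lbound T by exists x => y [/andP[]].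
have Sne : (S !=set0)%classic by exists 0.
have Tne : (T !=set0)%classic by exists 1.
have p0 : 0 <= sup S by exact: ub_le_sup.
have px : sup S <= x by apply: ge_sup => // y [/andP[]].
have q1 : inf T <= 1 by exact: ge_inf.
have xq : x <= inf T by apply: lb_le_inf => // y [/andP[]].
have incr y z : 0 <= y -> y <= z -> z <= 1 -> f y <= f z.
  move=> y0; rewrite le_eqVlt => /predU1P[->//|yz] z1; apply/ltW.
  exact: (thompson_incr fF).
have below y : sup S < y < inf T -> f y < y.
  move=> /andP[Sy yT]; rewrite ltNge; apply/negP => yf.
  have [yx|xy] := leP y x.
    have : S y by rewrite /S/= yx yf (le_trans p0 (ltW Sy)).
    by move=> /(ub_le_sup Sub); rewrite leNgt Sy.
  have : T y by rewrite /T/= yf (ltW xy) (le_trans (ltW yT) q1).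
  by move=> /(ge_inf Tlb); rewrite leNgt yT.
have pf : sup S <= f (sup S).
  apply: ge_sup => // y Sy; have [/andP[y0 yx] yf] := Sy.
  apply: le_trans yf _; apply: incr => //; first exact: ub_le_sup.
  exact: le_trans px x1.
have {}px : sup S < x.
  rewrite lt_neqAle px andbT; apply: contraTneq fx => E.
  by rewrite -leNgt -E.
(* The preimage [y] of [inf T] is [inf T] itself: if it were smaller, [f y < y] would fail, and a
   point [z] of [T] below [y] would satisfy [z <= f z < inf T]. *)
have qE : f (inf T) = inf T.
  have [|y /andP[y0 y1] fy] := thompson_surj fF (y := inf T).
    by rewrite q1 (le_trans x0 xq).
  have xy : x < y.
    rewrite ltNge; apply/negP => yx.
    have := incr _ _ y0 yx x1; rewrite fy => H.
    by have := le_lt_trans H fx; rewrite ltNge xq.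
  have qy : inf T <= y.
    rewrite leNgt; apply/negP => yq; have := below y.
    by rewrite (lt_trans px xy) yq fy => /(_ isT); rewrite ltNge ltW.
  suff yq : y <= inf T by rewrite -[RHS]fy; congr (f _); apply/eqP; rewrite eq_le qy.
  apply: lb_le_inf => // z [/andP[xz z1] zf]; rewrite leNgt; apply/negP => zy.
  have := thompson_incr fF (le_trans x0 xz) zy y1; rewrite fy.
  move=> /(le_lt_trans zf); rewrite ltNge ge_inf//.
  by rewrite /T/= xz z1.
have {}xq : x < inf T.
  by rewrite lt_neqAle xq andbT; apply: contraTneq fx => ->; rewrite qE ltxx.
have pE : f (sup S) = sup S.
  apply/eqP; rewrite eq_le pf andbT leNgt; apply/negP => pfp.
  (* This point gives the contradiction [f y < y <= f (sup S) <= f y]. *)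
  pose y := Num.min (f (sup S)) x.
  have py : sup S < y by rewrite lt_min pfp.
  have yx : y <= x by rewrite ge_min lexx orbT.
  have := below y; rewrite py (le_lt_trans yx xq) => /(_ isT) fy.
  have := incr _ _ p0 (ltW py) (le_trans yx x1).
  by move=> /le_lt_trans/(_ fy); rewrite lt_min ltxx.
by exists (sup S), (inf T); rewrite p0 px xq q1; split.
Qed.

Lemma fixed_germ_slopes (f : thompson R 1) x : 0 <= x <= 1 -> f x < x ->
  exists p q k k', [/\ 0 <= p < 1 /\ 0 < q <= 1, f p = p /\ f q = q,
    germ_slope f p 1 k, germ_slope f q (-1) k' & 2 <= (k' - k)%:~R :> R].
Proof.
move=> x01 fx; have fF := thompson_funP f.
have [p [q [/andP[p0 px] /andP[xq q1] fp fq below]]] := fixed_neighbours x01 fx.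
have p01 : 0 <= p < 1 by rewrite p0 (lt_trans px)// (lt_le_trans xq).
have q01 : 0 < q <= 1 by rewrite q1 andbT (lt_trans _ xq)// (le_lt_trans p0).
have [pI qI] : inward p 1 /\ inward q (-1) by split; [left|right].
have [k fk] := germ_slope_ex fF pI; have [k' fk'] := germ_slope_ex fF qI.
exists p, q, k, k'; split=> //.
have pq : 0 < q - p by rewrite subr_gt0 (lt_trans px).
have two1 : 1 < (2 : R) by rewrite (ltr_nat R 1 2).
have k0 : k < 0.
  (* Half the distance keeps [p + s] strictly between [p] and [q], where [f] moves points down;
     comparing values there gives [2 ^ k < 1]. *)
  have [e e0 fE] := fk; pose s := Num.min e ((q - p) / 2).
  have s0 : 0 < s by rewrite lt_min e0 divr_gt0.
  have se : s <= e by rewrite ge_min lexx.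
  have sq : s <= (q - p) / 2 by rewrite ge_min lexx orbT.
  have := below (p + 1 * s); rewrite fE ?se ?(ltW s0)// fp !mul1r.
  rewrite ltrD2l gtr_pMl// => H.
  have {}H : 2 ^ k < (2 : R) ^ 0 by rewrite expr0z H//; lra.
  by move: H; rewrite ltr_eXz2l.
have k'0 : 0 < k'.
  have [e e0 fE] := fk'; pose s := Num.min e ((q - p) / 2).
  have s0 : 0 < s by rewrite lt_min e0 divr_gt0.
  have se : s <= e by rewrite ge_min lexx.
  have sq : s <= (q - p) / 2 by rewrite ge_min lexx orbT.
  have := below (q + -1 * s); rewrite fE ?se ?(ltW s0)// fq !mulN1r mulNr.
  rewrite ltrD2l ltrN2 ltr_pMl// => H.
  have {}H : (2 : R) ^ 0 < 2 ^ k' by rewrite expr0z H//; lra.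
  by move: H; rewrite ltr_eXz2l.
(* Integrality turns the signs into [k <= -1] and [k' >= 1]. *)
rewrite (_ : 2 = 2%:~R)// ler_int; lia.
Qed.

(** Strings in both orientations are covered, so that the bound also applies when it is the inverse
    of the given element that moves a point down. *)
Lemma string_length_act_ge (f : thompson R 1) x y : 0 <= x <= 1 -> f x < x ->
  forall l, string_length (act f y) y l \/ string_length y (act f y) l ->
    Num.sqrt 2 <= l.
Proof.
move=> x01 fx l.
have [p [q [k [k' [[p01 q01] [fp fq] fk fk' kk]]]]] := fixed_germ_slopes x01 fx.
have gapE := height_gap_act y p01 q01 fp fq fk fk'.
move=> H; have {}H : 2 <= Num.sqrt 2 * l.
  apply: le_trans kk _; rewrite rmorphB/= -gapE; apply: le_trans (ler_norm _) _.
  case: H => /(height_gap_lipschitz p01 q01)//.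
  by rewrite distrC.
have s0 : 0 < Num.sqrt (2 : R) by rewrite sqrtr_gt0.
by rewrite -(ler_pM2l s0) -expr2 sqr_sqrtr.
Qed.

Lemma translation_length_ge (f : thompson R 1) : f <> thompson_one R ->
  ((Num.sqrt 2)%:E <= translation_length (act f))%E.
Proof.
move=> f1; have [x x01 fx] : exists2 x, 0 <= x <= 1 & f x != x.
  apply: contra_notP f1 => H; apply: thompson_eq => x x01 /=.
  rewrite /id01 in_itv/= x01; apply/eqP/negPn/negP => fx; apply: H.
  by exists x.
apply/ereal_infP => _ [y _ <-]; apply/ereal_infP => _ [l ly <-].
rewrite lee_fin.
have [fx'|xf|E] := ltgtP (f x) x; last by rewrite E eqxx in fx.
  by apply: (string_length_act_ge (y := y) x01 fx'); left.
(* Here [f] moves [x] up, so its inverse [h] moves [f x] down to [x]; a string from [act f y] to [y]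
   is one from [act f y] to its image under [h]. *)
have [h hP] := thompson_inverse_elt f.
have fx01 : 0 <= f x <= 1 := thompson_bound (thompson_funP f) x01.
have hf : h (f x) < f x by have [_ _ ->] := hP x x01.
have fK : act h (act f y) = y by apply: act_cancel => z /hP[].
apply: (string_length_act_ge (y := act f y) fx01 hf); right.
by rewrite fK.
Qed.

End LowerBound.

(** * Sharpness: an element of translation length exactly the square root of 2 *)

Section Sharpness.
Context {R : realType}.

(* The generator x_0 of F is convex, hence the maximum of its affine pieces. *)
Definition shift_map (x : R) : R :=
  if x \in `[0, 1] then Num.max (Num.max (x / 2) (x - 1 / 4)) (2 * x - 1) else 0.

Lemma shift_mapE (x : R) : 0 <= x <= 1 ->
  shift_map x = Num.max (Num.max (x / 2) (x - 1 / 4)) (2 * x - 1).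
Proof. by move=> x01; rewrite /shift_map in_itv/= x01. Qed.

Lemma shift_map_low (x : R) : 0 <= x <= 1 / 2 -> shift_map x = x / 2.
Proof.
move=> x01; rewrite shift_mapE; last by lra.
by rewrite [Num.max (x / 2) _]max_l ?max_l//; lra.
Qed.

Lemma shift_map_mid (x : R) : 1 / 2 <= x <= 3 / 4 -> shift_map x = x - 1 / 4.
Proof.
move=> x01; rewrite shift_mapE; last by lra.
by rewrite [Num.max (x / 2) _]max_r ?max_l//; lra.
Qed.

Lemma shift_map_high (x : R) : 3 / 4 <= x <= 1 -> shift_map x = 2 * x - 1.
Proof.
move=> x01; rewrite shift_mapE; last by lra.
by rewrite [Num.max (x / 2) _]max_r ?max_r//; lra.
Qed.

Lemma shift_map_incr (x y : R) : 0 <= x -> x < y -> y <= 1 ->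
  shift_map x < shift_map y.
Proof.
move=> x0 xy y1; rewrite !shift_mapE; [|lra|lra].
rewrite !gt_max !lt_max; apply/andP; split; [apply/andP; split|]; apply/orP.
(* Each affine piece at [x] lies below the same piece at [y]. *)
- by left; apply/orP; left; lra.
- by left; apply/orP; right; lra.
- by right; lra.
Qed.

Lemma shift_map_thompson : thompson_like 1 shift_map.
Proof.
have f0 : shift_map 0 = 0 by rewrite shift_map_low; lra.
have f1 : shift_map 1 = 1 by rewrite shift_map_high; lra.
have bij : set_bij `[0, 1]%classic `[0, 1]%classic shift_map.
  split=> [x|x y|y] /=; rewrite ?in_itv/= ?(inE, in_itv)/=.
  - by move=> x01; rewrite shift_mapE// !le_max !ge_max; apply/andP; split; lra.
  - move=> /andP[x0 x1] /andP[y0 y1] E; have [xy|yx|//] := ltgtP x y.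
      by have := shift_map_incr x0 xy y1; rewrite E ltxx.
    by have := shift_map_incr y0 yx x1; rewrite E ltxx.
  (* The thresholds [1 / 4] and [1 / 2] are the values at the breaking points [1 / 2] and
     [3 / 4]. *)
  - move=> y01; have [y4|y4] := leP y (1 / 4).
      by exists (2 * y); rewrite /= ?in_itv/= ?shift_map_low; lra.
    have [y2|y2] := leP y (1 / 2).
      by exists (y + 1 / 4); rewrite /= ?in_itv/= ?shift_map_mid; lra.
    by exists ((y + 1) / 2); rewrite /= ?in_itv/= ?shift_map_high; lra.
split=> //.
- by apply: (@thompson_continuous R 1) => //; [exact: shift_map_incr|case: bij].
- exists [:: 1 / 2; 3 / 4]; split=> [b|a b a0 ab b1 nb].
    rewrite !inE => /orP[] /eqP->.
      by exists 1, 1%N; rewrite expr1.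
    by exists 3, 2%N; field.
  have nbh (c : R) : c \in [:: 1 / 2; 3 / 4] -> c <= a \/ b <= c.
    move=> cs; have [|ac] := leP c a; first by left.
    have [|cb] := leP b c; first by right.
    by have := nb c; rewrite ac cb cs => /(_ isT).
  have [ha|hb] := nbh (3 / 4) (mem_last (1 / 2) [:: 3 / 4]).
    exists 1, (- 1) => x xab; rewrite shift_map_high ?expr1z//; lra.
  have [ha|hb'] := nbh (1 / 2) (mem_head _ _).
    exists 0, (- (1 / 4)) => x xab; rewrite shift_map_mid ?expr0z; lra.
  exists (- 1), 0 => x xab; rewrite shift_map_low; last by lra.
  by rewrite exprN1; lra.
- by move=> x /negbTE; rewrite /shift_map => ->.
Qed.

Definition double_map (x : R) : R := if x \in `[0, 1] then 2 * x else 0.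

Lemma double_map_thompson : thompson_like 2 double_map.
Proof.
have dE (x : R) : 0 <= x <= 1 -> double_map x = 2 * x.
  by move=> x01; rewrite /double_map in_itv/= x01.
have d0 : double_map 0 = 0 by rewrite dE; lra.
have d1 : double_map 1 = 2 by rewrite dE; lra.
have incr (x y : R) : 0 <= x -> x < y -> y <= 1 -> double_map x < double_map y.
  by move=> x0 xy y1; rewrite !dE; lra.
have bij : set_bij `[0, 1]%classic `[0, 2]%classic double_map.
  split=> [x|x y|y] /=; rewrite ?in_itv/= ?(inE, in_itv)/=.
  - by move=> x01; rewrite dE//; lra.
  - by move=> x01 y01; rewrite !dE//; lra.
  - by move=> y01; exists (y / 2); rewrite /= ?in_itv/= ?dE; lra.
split=> //.
- by apply: (@thompson_continuous R 2) => //; case: bij.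
- exists [::]; split=> // a b a0 ab b1 _.
  by exists 1, 0 => x xab; rewrite dE ?expr1z; lra.
- by move=> x /negbTE; rewrite /double_map => ->.
Qed.

Definition shift_elt : thompson R 1 := Thompson shift_map_thompson.
Definition double_elt : thompson R 2 := Thompson double_map_thompson.

Lemma shift_elt_neq1 : shift_elt <> thompson_one R.
Proof.
move=> /(congr1 (fun g : thompson R 1 => g (1 / 2))) /=.
rewrite shift_map_low /id01 ?in_itv/=; last by lra.
case: ifPn; lra.
Qed.

(** On the unit interval both sides equal [2 * x] up to [1 / 2] and [4 * x - 1] after it. Hence
    [shift_elt] carries one corner of the square of [double_elt] to the opposite one. *)
Lemma shift_label : vertex_label (thompson_rcomp double_elt shift_elt) [set ord0] =
  vertex_label double_elt [set ord_max].
Proof.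
apply/funext => x; rewrite /vertex_label /=.
have [x01|x01] := boolP (0 <= x <= 1); last first.
  rewrite /shift_map /double_map !in_itv/= (negbTE x01) ler01 lexx/=.
  by rewrite /stretch !big_set1/= mulr0 !add0r max_l ?max_l//; lra.
have fx : 0 <= shift_map x <= 1 by apply: (thompson_bound shift_map_thompson).
rewrite /double_map !in_itv/= x01 fx /stretch !big_set1/= subr0.
have [x2|x2] := leP x (1 / 2).
  rewrite shift_map_low ?x2; last by lra.
  by rewrite (max_r (x := 0)) ?min_r ?max_l ?min_r; lra.
have [x4|x4] := leP x (3 / 4).
  rewrite shift_map_mid ?x2; last by lra.
  by rewrite !(max_r (x := 0)) ?min_r; lra.
rewrite shift_map_high; last by lra.
by rewrite !(max_r (x := 0)) 1?min_l ?min_r; lra.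
Qed.

Lemma char_vec_in_cube n (J : {set 'I_n}) : in_cube (char_vec J : 'rV[R]_n).
Proof. by move=> i; rewrite mxE; case: (i \in J); rewrite ?ler01 ?lexx. Qed.

Lemma to_X_vertex n m (g : thompson R n) (h : thompson R m) J J' :
  vertex_label g J = vertex_label h J' ->
  to_X (CubePoint g (char_vec_in_cube J)) = to_X (CubePoint h (char_vec_in_cube J')).
Proof.
move=> gh; apply/eqmodP/asboolP/Relation_Operators.rst_step; rewrite /glued/=.
(* A single vertex is a face, and the gluing map is constant. *)
exists J, J, J', J', 0, (char_vec J'); split.
- by rewrite !subxx.
- move=> I /andP[a b]; have -> : I = J by apply/eqP; rewrite finset.eqEsubset a b.
  by exists J'; rewrite /between !subxx mulmx0 add0r.
- move=> I /andP[a b]; have -> : I = J' by apply/eqP; rewrite finset.eqEsubset a b.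
  by exists J; rewrite /between !subxx mulmx0 add0r.
- by split=> [|i iJ|i iJ]; rewrite ?mxE ?iJ ?(negbTE iJ)//; exact: char_vec_in_cube.
- by rewrite mulmx0 add0r.
Qed.

Lemma shift_translation_length_le :
  (translation_length (act shift_elt) <= (Num.sqrt 2)%:E)%E.
Proof.
pose a : 'rV[R]_2 := char_vec [set ord0]; pose b : 'rV[R]_2 := char_vec [set ord_max].
pose x := to_X (CubePoint double_elt (char_vec_in_cube [set ord0])).
have fx : act shift_elt x = to_X (CubePoint double_elt (char_vec_in_cube [set ord_max])).
  by rewrite act_to_X; exact: (to_X_vertex shift_label).
apply: le_trans (ereal_inf_lbound _) _; first by exists x.
apply: ereal_inf_lbound; exists (Num.sqrt 2) => //=; rewrite fx.
(* The string is one segment, the diagonal of the unit square. *)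
have <- : euclidean_dist b a + 0 = Num.sqrt 2.
  rewrite addr0 /euclidean_dist; congr Num.sqrt.
  by rewrite big_ord_recl big_ord1 !mxE !inE/=; ring.
exact: (string_cons _ (string_nil x)).
Qed.

End Sharpness.

Theorem corollary1 (R : realType) :
  [/\ forall f : thompson R 1, f <> thompson_one R ->
        is_isometry (act f) /\ is_ballistic (act f),
      exists2 c : R, 0 < c &
        forall f : thompson R 1, f <> thompson_one R ->
          (c%:E <= translation_length (act f))%E,
      forall f : thompson R 1, f <> thompson_one R ->
        ((Num.sqrt 2)%:E <= translation_length (act f))%E
    & exists2 f : thompson R 1, f <> thompson_one R &
        translation_length (act f) = (Num.sqrt 2)%:E].
Proof.
have s0 : 0 < Num.sqrt (2 : R) by rewrite sqrtr_gt0.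
split=> [f f1||f|].
- split; first exact: act_is_isometry.
  by rewrite /is_ballistic (lt_le_trans _ (translation_length_ge f1))// lte_fin.
- by exists (Num.sqrt 2) => // f; exact: translation_length_ge.
- exact: translation_length_ge.
- exists (@shift_elt R); first exact: shift_elt_neq1.
  apply/eqP; rewrite eq_le shift_translation_length_le.
  exact: translation_length_ge shift_elt_neq1.
Qed.
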